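(* Let $(A,\wedge,\mathfrak d)$ be a differential graded algebra with a Euclidean or Hermitian metric $\langle\cdot,\cdot\rangle$, such that $\mathfrak d$ has a formal adjoint $\mathfrak d^*$ and $A$ has a Hodge decomposition $$A=\mathcal H\oplus\operatorname{Im}\mathfrak d\oplus\operatorname{Im}\mathfrak d^*,$$ where $\mathcal H=\operatorname{Ker}\square_{\mathfrak d}$ and $\square_{\mathfrak d}=\mathfrak d\mathfrak d^*+\mathfrak d^*\mathfrak d$. Then there is a canonical $A_\infty$ structure on $\mathcal H$ with $m_2=\circ$, where $\alpha\circ\beta=(\alpha\wedge\beta)^H$ for $\alpha,\beta\in\mathcal H$.
   Context: A differential graded algebra $(A,\wedge,\mathfrak d)$ is a $\mathbb Z$-graded vector space $A=\bigoplus_n A^n$ with an associative graded product $\wedge$ and a differential $\mathfrak d$ of degree $1$ ($\mathfrak d^2=0$) that is a graded derivation of $\wedge$. A formal adjoint of $\mathfrak d$ is a linear operator $\mathfrak d^*:A\to A$ with $\langle\mathfrak d a,b\rangle=\langle a,\mathfrak d^*b\rangle$ for all $a,b\in A$. For $\alpha\in A$, $\alpha^H$ denotes the component of $\alpha$ in $\mathcal H$ under the Hodge decomposition. An $A_\infty$ structure (in the sense of Stasheff) on a $\mathbb Z$-graded vector space $B$ is a sequence of linear maps $m_k:B^{\otimes k}\to B$, $k\ge1$, with $\deg m_k=2-k$, satisfying the sequence of higher associativity identities. The first of these say that $m_1^2=0$, that $m_1(m_2(a_1\otimes a_2))=m_2(m_1(a_1)\otimes a_2)+(-1)^{|a_1|}m_2(a_1\otimes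 m_1(a_2))$, and that $m_2$ is associative up to a homotopy given by $m_3$ with respect to the differential $m_1$. In particular, if $m_1=0$ then $m_2$ is associative. The word ''canonical'' is used informally, without a formal definition.
   Formalization: The formal adjoint d* is additionally assumed to have degree −1 (automatic when distinct degrees of A are orthogonal for the metric); without this, H = Ker □ need not be a graded subspace and an A∞ structure on it is undefined. *)

(* Defs.v *)
From HB Require Import structures.
From mathcomp Require Import all_boot all_order all_algebra sesquilinear.
From mathcomp Require Import complex.
From mathcomp Require Import boolp classical_sets reals.

Set Implicit Arguments.
Unset Strict Implicit.
Unset Printing Implicit Defensive.

Import GRing.Theory.
Local Open Scope ring_scope.

Variant metric_kind := Euclidean | Hermitian.

Definition scalars (R : realType) (k : metric_kind) : numFieldType :=
  match k with Euclidean => R | Hermitian => R[i] end.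

Definition scalar_conj (R : realType) (k : metric_kind) :
    scalars R k -> scalars R k :=
  match k with Euclidean => fun x => x | Hermitian => fun x : R[i] => x^*%R end.

(* V is the internal direct sum of the subspaces gr n, n in Z. *)
Record is_grading (K : fieldType) (V : lmodType K) (gr : int -> {pred V}) :
    Prop := IsGrading {
  grading_submod : forall n, submod_closed (gr n);
  grading_span : forall v, exists (s : seq int) (c : int -> V),
    (forall n, c n \in gr n) /\ v = \sum_(n <- s) c n;
  grading_free : forall (s : seq int) (c : int -> V),
    uniq s -> (forall n, c n \in gr n) ->
    \sum_(n <- s) c n = 0 -> forall n, n \in s -> c n = 0
}.

(* a is a list of homogeneous elements, with degrees listed in p. *)
Definition homog (K : fieldType) (V : lmodType K) (gr : int -> {pred V})
    (p : seq int) (a : seq V) : bool :=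
  all2 (fun n x => x \in gr n) p a.

(* No unit and no graded commutativity are required. *)
Record dga (K : fieldType) := DGA {
  dga_space :> lmodType K;
  dga_hom : int -> {pred dga_space};
  wedge : {bilinear dga_space -> dga_space -> dga_space};
  diff : {linear dga_space -> dga_space};
  dga_hom_grading : is_grading dga_hom;
  wedgeA : associative wedge;
  wedge_hom : forall m n a b,
    a \in dga_hom m -> b \in dga_hom n -> wedge a b \in dga_hom (m + n);
  diff_hom : forall n a, a \in dga_hom n -> diff a \in dga_hom (n + 1);
  diff_diff : forall a, diff (diff a) = 0;
  diff_wedge : forall n a b, a \in dga_hom n ->
    diff (wedge a b) = wedge (diff a) b + (-1) ^ n *: wedge a (diff b)
}.
Arguments diff {K d}.
Arguments wedge {K d}.
Arguments dga_hom {K} d n.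

(* An A_oo structure on B = (+)_n gr n. The multilinear map m_k is the
   restriction of m to lists of length k; the value m [::] is irrelevant. The
   Stasheff identity is
     \sum_(r + s + t = n) (-1)^(r + s t) m_(r+1+t) (1^r (x) m_s (x) 1^t) = 0,
   and moving m_s, of degree 2 - s, past a_1, ..., a_r yields the Koszul sign
   (-1)^(s (|a_1| + ... + |a_r|)). *)
Record is_Ainf (K : fieldType) (B : lmodType K) (gr : int -> {pred B})
    (m : seq B -> B) : Prop := IsAinf {
  Ainf_grading : is_grading gr;
  Ainf_multilinear : forall u v : seq B, linear (fun x => m (u ++ x :: v));
  Ainf_degree : forall p a, (0 < size a)%N -> homog gr p a ->
    m a \in gr ((\sum_(i <- p) i) + 2 - (size a)%:Z);
  Ainf_stasheff : forall p a, homog gr p a ->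
    \sum_(0 <= r < size a) \sum_(1 <= s < (size a - r).+1)
      (-1) ^ (r%:Z + s%:Z * (size a - r - s)%:Z
              + s%:Z * \sum_(i <- take r p) i)
        *: m (take r a ++ m (take s (drop r a)) :: drop (r + s) a) = 0
}.

Section Hodge.
Variables (K : fieldType) (A : dga K) (dstar : {linear A -> A}).

Definition formal_adjoint (g : A -> A -> K) : Prop :=
  forall a b, g (diff a) b = g a (dstar b).

Definition box (a : A) : A := diff (dstar a) + dstar (diff a).

Lemma box_is_linear : linear box.
Proof.
move=> c x y; rewrite /box !linearP scalerDr -!addrA; congr (_ + _).
by rewrite addrCA.
Qed.

Definition harmonic_pred : {pred A} := [pred a | box a == 0].

Lemma harmonic_submod_closed : submod_closed harmonic_pred.
Proof.
have box0 : box 0 = 0 by rewrite /box !linear0 addr0.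
split=> [|c x y]; first by rewrite !inE box0.
by rewrite !inE box_is_linear => /eqP-> /eqP->; rewrite scaler0 addr0.
Qed.

HB.instance Definition _ :=
  GRing.isSubmodClosed.Build K A harmonic_pred harmonic_submod_closed.

Record harmonic := Harmonic { hval : A; _ : hval \in harmonic_pred }.

HB.instance Definition _ := [isSub for hval].
HB.instance Definition _ := [Choice of harmonic by <:].
HB.instance Definition _ := [SubChoice_isSubLmodule of harmonic by <:].

Definition harmonic_hom (n : int) : {pred harmonic} :=
  [pred h | hval h \in dga_hom A n].

Record hodge_decomposition : Prop := HodgeDecomposition {
  hodge_span : forall a : A, exists (h : harmonic) (b c : A),
    a = hval h + diff b + dstar c;
  hodge_free : forall (h : harmonic) (b c : A),
    hval h + diff b + dstar c = 0 -> [/\ h = 0, diff b = 0 & dstar c = 0]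
}.

(* The component a^H of a. *)
Definition harm_part (a : A) : harmonic :=
  xget 0 [set h : harmonic | exists b c : A, a = hval h + diff b + dstar c].

Definition circ (a b : harmonic) : harmonic := harm_part (wedge (hval a) (hval b)).

(* G inverts box on Im diff (+) Im dstar and vanishes on harmonic elements. *)
Definition green (a : A) : A :=
  xget 0 [set g : A | box g = a - hval (harm_part a) /\ harm_part g = 0].

(* The homotopy Q = dstar G, which satisfies diff Q + Q diff = 1 - (-)^H. *)
Definition hodge_homotopy (a : A) : A := dstar (green a).

(* The A_oo structure that the Hodge data determine by Merkulov's formulas:
   m_1 = 0 and m_n = (lambda_n)^H for n >= 2, where, with the convention
   Q lambda_1 = - 1,
     lambda_n (a_1, ..., a_n) =
       \sum_(k + l = n) (-1)^(1 + k + (l - 1) (|a_1| + ... + |a_k|))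
         wedge (Q lambda_k (a_1, ..., a_k)) (Q lambda_l (a_(k+1), ..., a_n)).
   In particular lambda_2 is the product of A. *)
Definition Qlambda (lambda : seq harmonic -> A) (a : seq harmonic) : A :=
  if a is [:: x] then - hval x else hodge_homotopy (lambda a).

Definition merkulov (m : seq harmonic -> harmonic) : Prop :=
  (forall x, m [:: x] = 0) /\
  exists lambda : seq harmonic -> A,
    forall p a, (1 < size a)%N -> homog harmonic_hom p a ->
      lambda a = \sum_(1 <= k < size a)
        (-1) ^ (1 + k%:Z + ((size a - k)%:Z - 1) * \sum_(i <- take k p) i)
          *: wedge (Qlambda lambda (take k a)) (Qlambda lambda (drop k a))
      /\ m a = harm_part (lambda a).

End Hodge.

(* Main.v *)
(* Homological perturbation in suspended signs. Let eps be the sign involution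
   of A and b (x, y) = eps x /\ y the product carried to the suspension. Define
     F a = [a has length 1] a_1 - Q (L a),
     L a = \sum_(a = u ++ v) b (F u, F v),  M = (L)^H,
     D G a = \sum_(a = u ++ v ++ w) +/- G (u, M v, w).
   The Leibniz rule, associativity and diff Q + Q diff = 1 - (-)^H give, by
   induction on the length of a,
     diff (F a) + L a = D F a   and   diff (L a) + D L a = 0,
   and the harmonic part of the second identity is the suspended Stasheff
   identity D M = 0. In these identities the sign +/- is the action of - eps on
   the entries of u, so they hold for arbitrary lists, and degrees matter only
   when M is transported back to the unsuspended signs of is_Ainf. *)
Require Import Defs.
From HB Require Import structures.
From mathcomp Require Import all_boot all_order all_algebra sesquilinear.
From mathcomp Require Import complex.
From mathcomp Require Import boolp classical_sets reals.
Set Implicit Arguments.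
Unset Strict Implicit.
Unset Printing Implicit Defensive.
Import GRing.Theory.
Local Open Scope ring_scope.

(** * Signs with integer exponents *)

Lemma expN1D (K : fieldType) (x y : int) :
  (-1 : K) ^ (x + y) = (-1) ^ x * (-1) ^ y.
Proof. by rewrite expfzDr // oppr_eq0 oner_eq0. Qed.

Lemma expN1_sqr (K : fieldType) (x : int) : (-1 : K) ^ x * (-1) ^ x = 1.
Proof. by rewrite -expfzMl mulrNN mulr1 exp1rz. Qed.

Lemma expN1N (K : fieldType) (x : int) : (-1 : K) ^ (- x) = (-1) ^ x.
Proof.
have n1 : (-1 : K) != 0 by rewrite oppr_eq0 oner_eq0.
by apply: (mulIf (expfz_neq0 x n1)); rewrite -expN1D addNr expN1_sqr.
Qed.

Arguments expN1D {K}.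

(** * Sums over the decompositions of a list *)

Section SplitSum.
Variables (T : Type) (V : zmodType).
Implicit Types (f g : seq T -> seq T -> V) (a u v : seq T).

(** Both blocks of a cut may be empty. Recursion on the list, rather than a sum over cut positions,
    makes the coalgebra identities below plain inductions. *)
Fixpoint split_sum f a : V :=
  f [::] a + (if a is x :: s then split_sum (fun u v => f (x :: u) v) s else 0).

Lemma split_sum_nat f a :
  split_sum f a = \sum_(0 <= k < (size a).+1) f (take k a) (drop k a).
Proof.
elim: a f => [|x s IH] f /=; first by rewrite big_nat1 addr0.
by rewrite big_nat_recl //= IH.
Qed.

Lemma eq_split_sum f g a :
  (forall u v, a = u ++ v -> f u v = g u v) -> split_sum f a = split_sum g a.
Proof.
by move=> fg; rewrite !split_sum_nat; apply: eq_bigr => k _;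
  rewrite fg ?cat_take_drop.
Qed.

Lemma split_sum0 f a :
  (forall u v, f u v = 0) -> split_sum f a = 0.
Proof. by move=> f0; rewrite split_sum_nat big1. Qed.

Lemma split_sum_ind (S : {pred V}) f a :
  0 \in S -> {in S &, forall x y, x + y \in S} ->
  (forall u v, a = u ++ v -> f u v \in S) -> split_sum f a \in S.
Proof.
move=> S0 SD fS; rewrite split_sum_nat.
apply: (big_ind (fun x => x \in S)) => // k _.
by rewrite fS ?cat_take_drop.
Qed.

Lemma split_sumD f g a :
  split_sum (fun u v => f u v + g u v) a = split_sum f a + split_sum g a.
Proof. by rewrite !split_sum_nat big_split. Qed.

Lemma split_sum_exchange (f : seq T -> seq T -> seq T -> seq T -> V) a b :
  split_sum (fun u v => split_sum (f u v) b) a =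
  split_sum (fun u' v' => split_sum (fun u v => f u v u' v') a) b.
Proof.
rewrite split_sum_nat; under eq_bigr do rewrite split_sum_nat.
rewrite exchange_big split_sum_nat /=.
by under [RHS]eq_bigr do rewrite split_sum_nat.
Qed.

(** Coassociativity of deconcatenation: both sides run over all ways to cut [a] into three
    consecutive blocks. *)
Lemma split_sum_coassoc (f : seq T -> seq T -> seq T -> V) a :
  split_sum (fun u v => split_sum (fun u1 u2 => f u1 u2 v) u) a =
  split_sum (fun u v => split_sum (f u) v) a.
Proof.
elim: a f => [|x s IH] f //=; rewrite split_sumD.
by rewrite (IH (fun u => f (x :: u))) !addr0 addrA.
Qed.

(** A cut falls either to the left or to the right of the marked entry [x]. Multilinearity and
    [coder_transfer_mul] both rest on this. *)
Lemma split_sum_insert f u x v :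
  split_sum f (u ++ x :: v) =
  split_sum (fun u1 u2 => f u1 (u2 ++ x :: v)) u
  + split_sum (fun v1 v2 => f (u ++ x :: v1) v2) v.
Proof.
elim: u f => [|y u IH] f /=; first by rewrite addr0.
by rewrite IH addrA.
Qed.

End SplitSum.

Lemma split_sum_map (T T' : Type) (V : zmodType) (h : T -> T')
    (f : seq T' -> seq T' -> V) a :
  split_sum f (map h a) = split_sum (fun u v => f (map h u) (map h v)) a.
Proof. by elim: a f => [|x s IH] f //=; rewrite IH. Qed.

Lemma split_sum_morph (T : Type) (V W : zmodType) (h : V -> W)
    (f : seq T -> seq T -> V) a :
  {morph h : x y / x + y} ->
  h (split_sum f a) = split_sum (fun u v => h (f u v)) a.
Proof.
move=> hD; have h0 : h 0 = 0 by apply: (addrI (h 0)); rewrite -hD !addr0.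
by rewrite !split_sum_nat (big_morph h hD h0).
Qed.

Definition multilinear (K : fieldType) (B C : lmodType K) (f : seq B -> C) :=
  forall u v, linear (fun x => f (u ++ x :: v)).

Lemma multilinear0 (K : fieldType) (B C : lmodType K) (f : seq B -> C) u v :
  multilinear f -> f (u ++ 0 :: v) = 0.
Proof.
by move=> /(_ u v (-1) 0 0); rewrite scaler0 addr0 scaleN1r addNr.
Qed.

(** * Transfer along a homotopy retract *)

Section Transfer.
Variables (K : fieldType) (A B : lmodType K).
Variables (mu : {bilinear A -> A -> A}) (d Q eA : {linear A -> A}).
Variables (P : {linear A -> B}) (i : {linear B -> A}) (eB : {linear B -> B}).
Hypothesis eAK : forall x, eA (eA x) = x.
Hypothesis eA_mu : forall x y, eA (mu x y) = mu (eA x) (eA y).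
Hypothesis eA_d : forall x, eA (d x) = - d (eA x).
Hypothesis eA_Q : forall x, eA (Q x) = - Q (eA x).
Hypothesis eA_i : forall x, eA (i x) = i (eB x).
Hypothesis muA : associative mu.
Hypothesis d_mu : forall x y, d (mu x y) = mu (d x) y + mu (eA x) (d y).
Hypothesis d_i : forall x, d (i x) = 0.
Hypothesis P_d : forall x, P (d x) = 0.
Hypothesis homotopy : forall x, d (Q x) + Q (d x) = x - i (P x).

Definition susp_mul x y : A := mu (eA x) y.
Definition susp_sign (x : B) : B := - eB x.

Lemma susp_mulDl x y z : susp_mul (x + y) z = susp_mul x z + susp_mul y z.
Proof. by rewrite /susp_mul linearD linearDl. Qed.
Lemma susp_mulDr x y z : susp_mul x (y + z) = susp_mul x y + susp_mul x z.
Proof. by rewrite /susp_mul linearDr. Qed.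
Lemma susp_mul0l y : susp_mul 0 y = 0.
Proof. by rewrite /susp_mul linear0 linear0l. Qed.
Lemma susp_mul0r x : susp_mul x 0 = 0.
Proof. by rewrite /susp_mul linear0r. Qed.
Lemma susp_mulBl x y z : susp_mul (x - y) z = susp_mul x z - susp_mul y z.
Proof. by rewrite /susp_mul linearB linearBl. Qed.
Lemma susp_mulBr x y z : susp_mul x (y - z) = susp_mul x y - susp_mul x z.
Proof. by rewrite /susp_mul linearBr. Qed.

(** Suspension shifts degrees by one, so the sign of the suspended degree is [- eA]. In these signs
    [susp_mul] is odd and the Leibniz rule says that [d] anticommutes with it. *)
Lemma d_susp_mul x y :
  d (susp_mul x y) = - susp_mul (d x) y - susp_mul (- eA x) (d y).
Proof.
rewrite /susp_mul d_mu eAK linearN linearNl opprK eAK eA_d linearNl opprK //.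
Qed.

(** In suspended signs the two bracketings of a triple product are opposite instead of equal. *)
Lemma susp_mulA x y z :
  susp_mul (susp_mul x y) z + susp_mul (- eA x) (susp_mul y z) = 0.
Proof.
by rewrite /susp_mul eA_mu !linearN linearNl !eAK muA subrr.
Qed.

Definition incl (a : seq B) : A := if a is [:: x] then i x else 0.

(** The sum over planar binary trees with [i] at the leaves and [susp_mul] followed by [- Q] at each
    vertex. The fuel [n] is there because cuts with an empty block make the recursion
    non-structural. *)
Fixpoint transfer_rec (n : nat) (a : seq B) : A :=
  if n is n'.+1 then
    incl a - Q (split_sum (fun u v =>
      susp_mul (transfer_rec n' u) (transfer_rec n' v)) a)
  else 0.

Definition transfer a := transfer_rec (size a) a.
Definition transfer_mul a :=
  split_sum (fun u v => susp_mul (transfer u) (transfer v)) a.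
Definition induced a := P (transfer_mul a).

Lemma transfer_rec_nil n : transfer_rec n [::] = 0.
Proof.
case: n => //= n; elim: n => [|n IH] /=;
  by rewrite ?IH ?susp_mul0l !addr0 linear0 subr0.
Qed.

(** An empty block contributes a zero factor, and in any other cut both blocks are strictly shorter
    than the list, so one unit less of fuel still suffices. *)
Lemma transfer_rec_stable n m a :
  (size a <= n)%N -> (size a <= m)%N -> transfer_rec n a = transfer_rec m a.
Proof.
elim: n m a => [|n IH] m a.
  by rewrite leqn0 size_eq0 => /eqP-> _; rewrite !transfer_rec_nil.
case: m => [|m]; first by rewrite leqn0 size_eq0 => _ /eqP->;
  rewrite !transfer_rec_nil.
move=> an am /=; congr (_ - Q _); apply: eq_split_sum => u v E.
case: u E => [|x u] E; first by rewrite !transfer_rec_nil !susp_mul0l.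
case: v E => [|y v] E; first by rewrite !transfer_rec_nil !susp_mul0r.
move: an am; rewrite E size_cat /= addSn !ltnS => an am.
congr susp_mul; apply: IH => //=; first
  [apply: leq_trans an|apply: leq_trans am].
all: by rewrite ?addnS ?ltnS ?leq_addr ?leq_addl //
  (leq_trans (leq_addl _ _) (leqnSn _)).
Qed.

Lemma transferE a : transfer a = incl a - Q (transfer_mul a).
Proof.
rewrite /transfer (@transfer_rec_stable _ (size a).+1) //=; congr (_ - Q _).
apply: eq_split_sum => u v ->.
by congr susp_mul; apply: transfer_rec_stable;
  rewrite // size_cat ?leq_addr ?leq_addl.
Qed.

Lemma transfer_nil : transfer [::] = 0.
Proof. exact: transfer_rec_nil. Qed.

Lemma transfer_mul_nil : transfer_mul [::] = 0.
Proof. by rewrite /transfer_mul /= transfer_nil susp_mul0l addr0. Qed.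

Lemma transfer_mul1 x : transfer_mul [:: x] = 0.
Proof. by rewrite /transfer_mul /= transfer_nil susp_mul0l susp_mul0r !addr0.
Qed.

(** * Multilinearity of the transfer *)

Lemma incl_multilinear : multilinear incl.
Proof.
move=> [|y u] [|z v] c x x' /=; rewrite ?linearP ?scaler0 ?addr0 //.
all: by case: u => [|? ?] /=; rewrite scaler0 addr0.
Qed.

(** By [split_sum_insert] the varying entry lies in exactly one of the two blocks. *)
Lemma split_sum_multilinear (C : lmodType K) (f : seq B -> seq B -> C) :
  (forall v, multilinear (f ^~ v)) -> (forall u, multilinear (f u)) ->
  multilinear (split_sum f).
Proof.
move=> fl fr u v c x y; rewrite !split_sum_insert scalerDr addrACA.
pose h := @GRing.scale K C c.
have hD : {morph h : x y / x + y} by move=> ? ?; rewrite /h scalerDr.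
rewrite -!/(h _) !(split_sum_morph _ _ hD) -!split_sumD.
by congr (_ + _); apply: eq_split_sum => s t _; rewrite ?fl ?fr.
Qed.

Lemma susp_mul_multilinear (f g : seq B -> A) :
  multilinear f -> multilinear g ->
  multilinear (split_sum (fun u v => susp_mul (f u) (g v))).
Proof.
move=> fl gl; apply: split_sum_multilinear => w u v c x y.
- by rewrite fl /susp_mul linearP linearPl.
- by rewrite gl /susp_mul linearPr.
Qed.

Lemma transfer_rec_multilinear n : multilinear (transfer_rec n).
Proof.
elim: n => [|n IH] u v c x y /=; first by rewrite scaler0 addr0.
rewrite incl_multilinear (susp_mul_multilinear IH IH) linearP scalerBr opprD.
by rewrite addrACA.
Qed.

Lemma transfer_multilinear : multilinear transfer.
Proof.
move=> u v c x y; rewrite /transfer.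
by rewrite !size_cat /= transfer_rec_multilinear.
Qed.

Lemma transfer_mul_multilinear : multilinear transfer_mul.
Proof. exact: (susp_mul_multilinear transfer_multilinear transfer_multilinear).
Qed.

Lemma induced_multilinear : multilinear induced.
Proof. by move=> u v c x y; rewrite /induced transfer_mul_multilinear linearP.
Qed.

(** Since [susp_mul] is odd for [- eA], moving the sign into its factors costs one extra minus. *)
Lemma susp_sign_mul (f : seq B -> A) a :
  (forall u, - eA (f u) = f (map susp_sign u)) ->
  - eA (split_sum (fun u v => susp_mul (f u) (f v)) a) =
  - split_sum (fun u v => susp_mul (f u) (f v)) (map susp_sign a).
Proof.
move=> fS; rewrite split_sum_map; congr (- _).
rewrite (split_sum_morph _ _ (linearD eA)); apply: eq_split_sum => u v _.
by rewrite -!fS /susp_mul eA_mu (linearN eA) !eAK linearNr linearNl opprK.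
Qed.

(** [Q] and [susp_mul] are both odd, so their extra signs cancel and the transfer is even. *)
Lemma transfer_rec_sign n a :
  - eA (transfer_rec n a) = transfer_rec n (map susp_sign a).
Proof.
elim: n a => [|n IH] a /=; first by rewrite linear0 oppr0.
rewrite linearB /= eA_Q opprK opprD -(linearN Q) susp_sign_mul // (linearN Q).
by congr (_ - _); case: a => [|x [|y a]] /=;
  rewrite ?linear0 ?oppr0 // eA_i linearN.
Qed.

Lemma transfer_sign a : - eA (transfer a) = transfer (map susp_sign a).
Proof. by rewrite /transfer transfer_rec_sign size_map. Qed.

Lemma transfer_mul_sign a :
  eA (transfer_mul a) = transfer_mul (map susp_sign a).
Proof. by apply/oppr_inj; rewrite susp_sign_mul //; exact: transfer_sign. Qed.

(* G composed with the coderivation of the tensor coalgebra on the suspension of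
   B whose corestriction is induced. *)
Definition coder (C : zmodType) (G : seq B -> C) (a : seq B) : C :=
  split_sum (fun u vw => split_sum (fun v w =>
    G (map susp_sign u ++ induced v :: w)) vw) a.

Lemma coder_morph (C C' : zmodType) (h : C -> C') (G : seq B -> C) a :
  {morph h : x y / x + y} -> h (coder G a) = coder (fun b => h (G b)) a.
Proof.
move=> hD; rewrite /coder (split_sum_morph _ _ hD).
by apply: eq_split_sum => u v _; rewrite (split_sum_morph _ _ hD).
Qed.

Lemma coderD (C : zmodType) (G G' : seq B -> C) a :
  coder (fun b => G b + G' b) a = coder G a + coder G' a.
Proof.
rewrite /coder -split_sumD; apply: eq_split_sum => u v _.
by rewrite -split_sumD.
Qed.

(** [incl] sees only lists of length one, so the blocks around the inserted [induced v] must be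
    empty and [v] is all of [a]. *)
Lemma coder_incl a : coder incl a = i (induced a).
Proof.
rewrite /coder.
have E u v : split_sum (fun v w => incl (map susp_sign u ++ induced v :: w)) v
   = if u is [::] then i (induced v) else 0.
  case: u => [|x u]; last by apply: split_sum0 => ? ? /=; case: u.
  (* Here [u] is empty, and only the last cut, where [w] is empty too, leaves a list of length
     one. *)
  rewrite split_sum_nat big_nat_recr //= take_size drop_size big_nat big1
    ?add0r //.
  move=> k /andP[_ kv]; case E: (drop k v) => //.
  by move/(congr1 size): E; rewrite size_drop => /eqP;
    rewrite subn_eq0 leqNgt kv.
rewrite (eq_split_sum (g := fun u v => if u is [::] then i (induced v) else 0)).
  by case: a => [|x s] /=; rewrite ?(@split_sum0 _ _ (fun _ _ => 0)) ?addr0.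
by move=> u v _; rewrite E.
Qed.

(** The inserted entry lies in the left or in the right factor of the product. In the second case
    the signs on the left block collect into [- eA] by [transfer_sign]. *)
Lemma coder_transfer_mul a :
  coder transfer_mul a =
  split_sum (fun u v => susp_mul (coder transfer u) (transfer v)) a
  + split_sum (fun u v => susp_mul (- eA (transfer u)) (coder transfer v)) a.
Proof.
rewrite addrC /coder /transfer_mul.
(* Before regrouping, the outer sums choose the place of insertion and the innermost one cuts the
   product: before the inserted entry in the first sum, after it in the second. *)
transitivity (split_sum (fun u vw => split_sum (fun v w =>
    split_sum (fun u1 u2 => susp_mul (transfer (map susp_sign u1))
                              (transfer (map susp_sign u2 ++ induced v :: w)))
                                u) vw) a
  + split_sum (fun u vw => split_sum (fun v w => split_sum (fun w1 w2 =>
      susp_mul (transfer (map susp_sign u ++ induced v :: w1))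
        (transfer w2)) w) vw) a).
  rewrite -split_sumD; apply: eq_split_sum => u vw _; rewrite -split_sumD.
  by apply: eq_split_sum => v w _; rewrite split_sum_insert split_sum_map.
congr (_ + _).
- under eq_split_sum do rewrite -split_sum_exchange.
  rewrite (split_sum_coassoc (fun u1 u2 vw => split_sum (fun v w =>
    susp_mul (transfer (map susp_sign u1))
      (transfer (map susp_sign u2 ++ induced v :: w))) vw)).
  apply: eq_split_sum => u vw _; rewrite transfer_sign.
  rewrite (split_sum_morph _ _ (susp_mulDr _)); apply: eq_split_sum => v w _.
  by rewrite (split_sum_morph _ _ (susp_mulDr _)).
- under eq_split_sum do rewrite -(split_sum_coassoc (fun v w1 w2 => _)).
  rewrite -(split_sum_coassoc (fun u v w => split_sum (fun v1 w1 =>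
    susp_mul (transfer (map susp_sign u ++ induced v1 :: w1)) (transfer w)) v)).
  apply: eq_split_sum => u v _.
  have D : {morph susp_mul^~ (transfer v) : x y / x + y}.
    by move=> x y; exact: susp_mulDl.
  rewrite (split_sum_morph _ _ D); apply: eq_split_sum => u1 u2 _.
  by rewrite (split_sum_morph _ _ D).
Qed.

(** With [L = transfer_mul a], the homotopy formula gives [d (Q L) = L - i (P L) - Q (d L)]. The
    hypothesis turns [d L] into a [coder] term, and [i (P L)] is the term from [coder_incl]. *)
Lemma d_transfer_of_coder a :
  d (transfer_mul a) + coder transfer_mul a = 0 ->
  d (transfer a) = coder transfer a - transfer_mul a.
Proof.
move=> /eqP; rewrite addr_eq0 => /eqP dL.
have hD (C : zmodType) (G G' : seq B -> C) b :
    coder (fun x => G x - G' x) b = coder G b - coder G' b.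
  rewrite coderD; congr (_ + _); apply/esym.
  by apply: (coder_morph (h := -%R)) => x y; rewrite opprD.
have -> : coder transfer a = i (induced a) - Q (coder transfer_mul a).
  rewrite -coder_incl (coder_morph _ _ (linearD Q)) -hD.
  by apply: eq_split_sum => u v _; apply: eq_split_sum => v1 v2 _;
    rewrite transferE.
rewrite transferE linearB /=.
have -> : d (incl a) = 0 by case: a {dL} => [|x [|y a]] /=; rewrite ?linear0.
have := homotopy (transfer_mul a); rewrite dL linearN /= -/(induced a) => h.
move/(canRL (subrK _)): h => ->.
by rewrite sub0r !opprD opprK [RHS]addrC addrA.
Qed.

(** Induction on the length. After the Leibniz rule, [d_transfer_of_coder] on shorter blocks cancels
    every term with [d]. The two bracketings of triple products remain, and [susp_mulA] cancels
    them. *)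
Lemma d_transfer_mul a : d (transfer_mul a) + coder transfer_mul a = 0.
Proof.
have [n] := ubnP (size a); elim: n a => // n IH a; rewrite ltnS => an.
have IH' b :
    (size b < n)%N -> d (transfer b) = coder transfer b - transfer_mul b.
  by move=> bn; apply: d_transfer_of_coder; apply: IH.
rewrite coder_transfer_mul {1}/transfer_mul (split_sum_morph _ _ (linearD d)).
rewrite -!split_sumD.
transitivity (split_sum (fun u v => susp_mul (transfer_mul u) (transfer v)) a
  + split_sum (fun u v => susp_mul (- eA (transfer u)) (transfer_mul v)) a).
  rewrite -split_sumD; apply: eq_split_sum => u v E.
  have -> : susp_mul (coder transfer u) (transfer v) =
      susp_mul (d (transfer u)) (transfer v)
      + susp_mul (transfer_mul u) (transfer v).
    (* If [v] is empty then [u] is the whole list, out of reach of the induction hypothesis, but the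
       factor [transfer v] is zero. *)
    case: v E => [|y v] E; first by rewrite transfer_nil !susp_mul0r addr0.
    rewrite IH' ?susp_mulBl ?subrK //; apply: leq_trans an.
    by rewrite E size_cat /= addnS ltnS leq_addr.
  have -> : susp_mul (- eA (transfer u)) (coder transfer v) =
      susp_mul (- eA (transfer u)) (d (transfer v))
      + susp_mul (- eA (transfer u)) (transfer_mul v).
    case: u E => [|y u] E.
      by rewrite transfer_nil linear0 oppr0 !susp_mul0l addr0.
    rewrite IH' ?susp_mulBr ?subrK //; apply: leq_trans an.
    by rewrite E size_cat /= ltnS leq_addl.
  by rewrite d_susp_mul addrACA !addKr.
rewrite /transfer_mul.
transitivity (split_sum (fun u v => split_sum (fun u1 u2 =>
    susp_mul (susp_mul (transfer u1) (transfer u2)) (transfer v)) u) a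
  + split_sum (fun u v => split_sum (fun v1 v2 =>
    susp_mul (- eA (transfer u)) (susp_mul (transfer v1) (transfer v2))) v) a).
  congr (_ + _); apply: eq_split_sum => u v _.
  - have D : {morph susp_mul^~ (transfer v) : x y / x + y}.
      by move=> x y; exact: susp_mulDl.
    by rewrite (split_sum_morph _ _ D).
  - by rewrite (split_sum_morph _ _ (susp_mulDr _)).
rewrite (split_sum_coassoc (fun u v w =>
  susp_mul (susp_mul (transfer u) (transfer v)) (transfer w))) -split_sumD.
apply: split_sum0 => u v; rewrite -split_sumD.
by apply: split_sum0 => v1 v2; exact: susp_mulA.
Qed.

Lemma coder_induced a : coder induced a = 0.
Proof.
rewrite -(coder_morph _ _ (linearD P)).
have /eqP := d_transfer_mul a; rewrite addrC addr_eq0 => /eqP->.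
by rewrite linearN /= P_d oppr0.
Qed.


(** * Desuspension and degrees *)

Section Signs.
Hypothesis eB_P : forall x, eB (P x) = P (eA x).
Variables (grA : int -> {pred A}) (grB : int -> {pred B}).
Hypothesis grA_submod : forall n, submod_closed (grA n).
Hypothesis eA_hom : forall n x, x \in grA n -> eA x = (-1) ^ n *: x.
Hypothesis eB_hom : forall n x, x \in grB n -> eB x = (-1) ^ n *: x.
Hypothesis grB_submod : forall n, submod_closed (grB n).
Hypothesis i_hom : forall n x, x \in grB n -> i x \in grA n.
Hypothesis P_hom : forall n x, x \in grA n -> P x \in grB n.
Hypothesis Q_hom : forall n x, x \in grA n -> Q x \in grA (n - 1).
Hypothesis mu_hom : forall m n x y,
  x \in grA m -> y \in grA n -> mu x y \in grA (m + n).

Lemma homog_take k p a : homog grB p a -> homog grB (take k p) (take k a).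
Proof.
by elim: a p k => [|x a IH] [|n p] [|k] //= /andP[xn pa]; rewrite xn IH.
Qed.

Lemma homog_drop k p a : homog grB p a -> homog grB (drop k p) (drop k a).
Proof.
by elim: a p k => [|x a IH] [|n p] [|k] //= /andP[xn pa]; exact: IH.
Qed.

Lemma iter_eB_hom n s x : x \in grB n -> iter s eB x \in grB n.
Proof.
move=> xn; have [z0 zl] := grB_submod n.
elim: s => //= s IH; rewrite (eB_hom IH) -[_ *: _]addr0; exact: zl.
Qed.

Lemma iter_eB_sign n s x :
  x \in grB n -> iter s eB x = (-1) ^ (s%:Z * n) *: x.
Proof.
move=> xn; elim: s => [|s IH]; first by rewrite mul0r expr0z scale1r.
rewrite iterS (eB_hom (iter_eB_hom s xn)) IH scalerA -expN1D.
by rewrite -[n in n + _]mul1r -mulrDl.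
Qed.

Lemma homog_map_iter s p a : homog grB p a -> homog grB p (map (iter s eB) a).
Proof.
elim: a p => [|x a IH] [|n p] //= /andP[xn pa].
by rewrite iter_eB_hom //=; exact: IH.
Qed.

Lemma multilinearZ (C : lmodType K) (f : seq B -> C) u c x v :
  multilinear f -> f (u ++ c *: x :: v) = c *: f (u ++ x :: v).
Proof.
move=> fl; have := fl u v c x 0.
by rewrite /= (multilinear0 _ _ fl) !addr0.
Qed.

Lemma multilinear_map_iter (C : lmodType K) (f : seq B -> C) s p u v :
  multilinear f -> homog grB p u ->
  f (map (iter s eB) u ++ v) = (-1) ^ (s%:Z * \sum_(n <- p) n) *: f (u ++ v).
Proof.
(* The empty prefix is made explicit so that it can be generalized: the induction moves each treated
   entry into it. *)
move=> fl; rewrite -[map _ _ ++ _]cat0s -[u ++ v]cat0s.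
elim: u p [::] => [|x u IH] [|n p] w //.
  by rewrite big_nil mulr0 expr0z scale1r.
case/andP=> xn pu /=.
rewrite (iter_eB_sign _ xn) multilinearZ // -cat_rcons (IH p) // cat_rcons.
by rewrite scalerA -expN1D big_cons mulrDr.
Qed.

Lemma multilinear_map_susp (C : lmodType K) (f : seq B -> C) u v :
  multilinear f ->
  f (map susp_sign u ++ v) = (-1) ^ (size u)%:Z *: f (map eB u ++ v).
Proof.
move=> fl; rewrite -[map _ _ ++ _]cat0s -[map eB u ++ v]cat0s.
elim: u [::] => [|x u IH] w /=; first by rewrite scale1r.
rewrite /susp_sign -scaleN1r multilinearZ // -cat_rcons IH // cat_rcons.
by rewrite scalerA -exprSz.
Qed.

Lemma map_iterS s (u : seq B) :
  map eB (map (iter s eB) u) = map (iter s.+1 eB) u.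
Proof. by rewrite -map_comp. Qed.

Lemma map_iterD s t (u : seq B) :
  map (iter s eB) (map (iter t eB) u) = map (iter (s + t) eB) u.
Proof. by rewrite -map_comp; apply: eq_map => x /=; rewrite iterD. Qed.

(* On homogeneous lists, multiplies by the Koszul sign
   (-1)^(\sum_i (n - i) |a_i|) of the n-fold suspension. *)
Fixpoint twist (a : seq B) : seq B :=
  if a is x :: s then iter (size s) eB x :: twist s else [::].

Lemma size_twist a : size (twist a) = size a.
Proof. by elim: a => //= x a ->. Qed.

(** Every entry of [u] has [size v] more entries to its right in [u ++ v]. *)
Lemma twist_cat u v :
  twist (u ++ v) = map (iter (size v) eB) (twist u) ++ twist v.
Proof.
elim: u => //= x u ->; rewrite size_cat; congr (_ :: _).
by rewrite addnC iterD.
Qed.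

Lemma twist_homog p a : homog grB p a -> homog grB p (twist a).
Proof.
elim: a p => [|x a IH] [|n p] //= /andP[xn pa].
by rewrite iter_eB_hom //=; exact: IH.
Qed.

(** The desuspended operations. Since [twist] uses iterates of [eB] instead of degrees, they are
    multilinear on arbitrary lists. *)
Definition twisted a := induced (twist a).

Lemma iter_eB_linear s : linear (iter s eB).
Proof. by elim: s => [|s IH] c x y //=; rewrite IH linearP. Qed.

Lemma twisted_multilinear : multilinear twisted.
Proof.
move=> u v c x y; rewrite /twisted !twist_cat /= iter_eB_linear.
exact: induced_multilinear.
Qed.

(** Each passage of [eB] through [induced] puts [susp_sign] on the entries, which is [eB] with a
    factor -1 per entry. *)
Lemma iter_eB_induced t a :
  iter t eB (induced a) =
  (-1) ^ (t%:Z * (size a)%:Z) *: induced (map (iter t eB) a).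
Proof.
elim: t => [|t IH]; first by rewrite mul0r expr0z scale1r map_id.
rewrite iterS IH linearZ /= eB_P transfer_mul_sign -/(induced _).
rewrite -[map susp_sign _]cats0 (multilinear_map_susp _ _ induced_multilinear).
rewrite cats0 map_iterS scalerA size_map -expN1D; congr (_ ^ _ *: _).
by rewrite -addn1 PoszD mulrDl mul1r.
Qed.

(** The parts of the Stasheff sign have separate origins: [size u] comes from [susp_sign], the
    product of [size v] and [size w] from moving [eB] through the inner operation, and the Koszul
    sign from the [size v] iterates of [eB] by which the two sides differ on [u]. *)
Lemma twisted_stasheff_term q u v w : homog grB q u ->
  (-1) ^ ((size u)%:Z + (size v)%:Z * (size w)%:Z
          + (size v)%:Z * \sum_(n <- q) n) *: twisted (u ++ twisted v :: w) =
  induced (map susp_sign (map (iter (size v + size w) eB) (twist u))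
           ++ induced (map (iter (size w) eB) (twist v)) :: twist w).
Proof.
move=> qu; rewrite {1}/twisted twist_cat /= iter_eB_induced.
rewrite multilinearZ; last exact: induced_multilinear.
rewrite multilinear_map_susp; last exact: induced_multilinear.
rewrite map_iterS -addnS -map_iterD.
rewrite (multilinear_map_iter _ _ induced_multilinear
           (homog_map_iter _ (twist_homog qu))).
rewrite !scalerA !size_map !size_twist -!expN1D; congr (_ *: _).
rewrite [(size w)%:Z * _]mulrC -addrA addrACA.
by rewrite (expN1D (_ + _) (_ + _)) (expN1D ((size v)%:Z * _)) expN1_sqr mulr1.
Qed.

Lemma twisted_stasheff p a : homog grB p a ->
  \sum_(0 <= r < size a) \sum_(1 <= s < (size a - r).+1)
      (-1) ^ (r%:Z + s%:Z * (size a - r - s)%:Z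
              + s%:Z * \sum_(n <- take r p) n)
        *: twisted (take r a ++ twisted (take s (drop r a)) :: drop (r + s) a)
  = 0.
Proof.
move=> pa; rewrite -[RHS](coder_induced (twist a)) /coder split_sum_nat.
(* An empty inner block contributes zero. This removes [r = size a] and [s = 0] and leaves the
   ranges of the Stasheff identity. *)
have ind0 u w : induced (u ++ induced [::] :: w) = 0.
  rewrite {2}/induced transfer_mul_nil linear0 multilinear0 //.
  exact: induced_multilinear.
rewrite size_twist big_nat_recr //= drop_oversize ?size_twist //= ind0 !addr0.
apply: eq_big_nat => r /andP[_ ra].
rewrite split_sum_nat size_drop size_twist [RHS]big_ltn // take0 ind0 add0r.
apply: eq_big_nat => s /andP[_]; rewrite ltnS => sa.
set u := take r a; set v := take s (drop r a); set w := drop (r + s) a.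
have uvw : a = u ++ v ++ w by rewrite /w addnC -drop_drop !cat_take_drop.
have su : size u = r by rewrite size_takel // ltnW.
have sv : size v = s by rewrite size_takel // size_drop.
have sw : size w = (size a - r - s)%N by rewrite size_drop subnDA.
have := twisted_stasheff_term v w (homog_take r pa); rewrite -/u su sv sw => ->.
have -> : twist a = map (iter (s + size w) eB) (twist u)
    ++ map (iter (size w) eB) (twist v) ++ twist w.
  by rewrite uvw !twist_cat size_cat sv.
rewrite take_size_cat ?drop_size_cat ?size_map ?size_twist //.
by rewrite take_size_cat ?drop_size_cat ?size_map ?size_twist // sw.
Qed.

(** This is Merkulov's recursion. Of its sign, 1 comes from writing [eA] as minus [- eA], and [k]
    from [susp_sign] on the left block. *)
Lemma transfer_mul_twist p a : (1 < size a)%N -> homog grB p a ->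
  transfer_mul (twist a) = \sum_(1 <= k < size a)
    (-1) ^ (1 + k%:Z + ((size a - k)%:Z - 1) * \sum_(n <- take k p) n)
      *: mu (transfer (twist (take k a))) (transfer (twist (drop k a))).
Proof.
move=> a1 pa; rewrite /transfer_mul split_sum_nat size_twist.
rewrite big_nat_recr //= drop_oversize ?size_twist // transfer_nil susp_mul0r.
rewrite addr0 big_ltn ?(ltnW a1) // take0 transfer_nil susp_mul0l add0r.
apply: eq_big_nat => k /andP[_ ka].
set u := take k a; set v := drop k a.
have su : size u = k by rewrite size_takel // ltnW.
have sv : size v = (size a - k)%N by rewrite size_drop.
have -> : twist a = map (iter (size v) eB) (twist u) ++ twist v.
  by rewrite -twist_cat cat_take_drop.
rewrite take_size_cat ?drop_size_cat ?size_map ?size_twist // -sv.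
rewrite /susp_mul -[eA _]opprK transfer_sign.
rewrite -[map susp_sign _]cats0 (multilinear_map_susp _ _ transfer_multilinear).
rewrite map_iterS (multilinear_map_iter _ _ transfer_multilinear
           (twist_homog (homog_take k pa))) cats0 !size_map size_twist su.
rewrite scalerA -scaleN1r scalerA linearZl_LR /=; congr (_ *: _).
rewrite -[-1 in LHS]expr1z -!expN1D addrA !expN1D; congr (_ * _).
(* The left block carries [size v + 1] iterates of [eB], while the formula has [size v - 1], of the
   same parity. *)
rewrite -addn1 PoszD !mulrDl mul1r mulN1r !expN1D; congr (_ * _).
by rewrite expN1N.
Qed.

(** * Degrees of the transferred operations *)

Lemma susp_mul_hom m n x y :
  x \in grA m -> y \in grA n -> susp_mul x y \in grA (m + n).
Proof.
move=> xm yn; rewrite /susp_mul mu_hom // (eA_hom xm).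
by have [z0 zl] := grA_submod m; rewrite -[_ *: _]addr0 zl.
Qed.

Lemma split_sum_susp_mul_hom (f : seq B -> A) p a :
  (forall q b, homog grB q b ->
     f b \in grA (\sum_(n <- q) n + 1 - (size b)%:Z)) ->
  homog grB p a ->
  split_sum (fun u v => susp_mul (f u) (f v)) a
    \in grA (\sum_(n <- p) n + 2 - (size a)%:Z).
Proof.
move=> fh pa; have [z0 zl] := grA_submod (\sum_(n <- p) n + 2 - (size a)%:Z).
apply: split_sum_ind => // [x y xS yS|u v E]; first by rewrite -[x]scale1r zl.
have pu := homog_take (size u) pa; have pv := homog_drop (size u) pa.
rewrite E take_size_cat // in pu; rewrite E drop_size_cat // in pv.
have := susp_mul_hom (fh _ _ pu) (fh _ _ pv); congr (_ \in grA _).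
rewrite E size_cat PoszD -{3}(cat_take_drop (size u) p) big_cat /= opprD.
by rewrite addrACA (addrACA (\sum_(n <- take _ _) n)).
Qed.

Lemma transfer_rec_hom k p a : homog grB p a ->
  transfer_rec k a \in grA (\sum_(n <- p) n + 1 - (size a)%:Z).
Proof.
elim: k p a => [|k IH] p a pa /=;
  have [z0 zl] := grA_submod (\sum_(n <- p) n + 1 - (size a)%:Z) => //.
rewrite addrC -scaleN1r; apply: zl.
  have := Q_hom (split_sum_susp_mul_hom IH pa).
  by rewrite addrAC -(addrA _ 2 (-1)).
case: a p pa z0 => [|x [|y a]] [|n [|m p]] //=; last by rewrite andbF.
by rewrite andbT big_seq1 addrK => xn _; exact: i_hom.
Qed.

Lemma twisted_hom p a : homog grB p a ->
  twisted a \in grB (\sum_(n <- p) n + 2 - (size a)%:Z).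
Proof.
move=> pa; apply: P_hom; rewrite -[size a]size_twist.
apply: split_sum_susp_mul_hom (twist_homog pa) => q b.
exact: transfer_rec_hom.
Qed.

End Signs.

End Transfer.

(** * Homogeneous components *)

Section Grading.
Variables (K : fieldType) (V : lmodType K) (gr : int -> {pred V}).
Hypothesis grV : is_grading gr.
Implicit Types (v x y : V) (f : int -> V) (s t : seq int).

(** The list [s] need only contain the support of [f], so that two decompositions can be put on a
    common list. *)
Definition decomposes v f s :=
  [/\ forall n, f n \in gr n, uniq s, forall n, n \notin s -> f n = 0
    & v = \sum_(n <- s) f n].

Lemma grading0 n : 0 \in gr n.
Proof. by case: (grading_submod grV n). Qed.

Lemma gradingP n c x y : x \in gr n -> y \in gr n -> c *: x + y \in gr n.
Proof. by case: (grading_submod grV n) => _; apply. Qed.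

Lemma gradingD n x y : x \in gr n -> y \in gr n -> x + y \in gr n.
Proof. by rewrite -{2}[x]scale1r; exact: gradingP. Qed.

Lemma gradingB n x y : x \in gr n -> y \in gr n -> x - y \in gr n.
Proof. by move=> xn yn; rewrite addrC -scaleN1r gradingP. Qed.

Lemma sum_support s t f : uniq s -> uniq t -> {subset s <= t} ->
  (forall n, n \notin s -> f n = 0) -> \sum_(n <- t) f n = \sum_(n <- s) f n.
Proof.
move=> us ut st f0; rewrite (bigID (mem s)) /= [X in _ + X]big1 // addr0.
rewrite -big_filter; apply: perm_big; apply: uniq_perm => //.
  exact: filter_uniq.
by move=> n; rewrite mem_filter; case E: (n \in s) => //=; apply: st.
Qed.

Lemma decomposes_widen v f s t :
  decomposes v f s -> uniq t -> {subset s <= t} -> decomposes v f t.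
Proof.
move=> [fh us f0 ->] ut st; split=> // [n nt|];
  last by rewrite (sum_support us).
by apply: f0; apply: contra nt; exact: st.
Qed.

Lemma decomposes_common v w f g s s' : decomposes v f s -> decomposes w g s' ->
  exists t, decomposes v f t /\ decomposes w g t.
Proof.
move=> vf wg; exists (undup (s ++ s')); split.
- apply: decomposes_widen vf _ _; rewrite ?undup_uniq // => n.
  by rewrite mem_undup mem_cat => ->.
- apply: decomposes_widen wg _ _; rewrite ?undup_uniq // => n.
  by rewrite mem_undup mem_cat orbC => ->.
Qed.

Lemma decomposesP c v w f g s : decomposes v f s -> decomposes w g s ->
  decomposes (c *: v + w) (fun n => c *: f n + g n) s.
Proof.
move=> [fh us f0 ->] [gh _ g0 ->]; split=> // [n|n ns|].
- exact: gradingP.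
- by rewrite f0 // g0 // scaler0 addr0.
- by rewrite scaler_sumr big_split.
Qed.

Lemma decomposes_hom n x : x \in gr n ->
  decomposes x (fun m => if m == n then x else 0) [:: n].
Proof.
move=> xn; split=> // [m|m|].
- by case: eqP => [->|_] //; exact: grading0.
- by rewrite inE => /negPf->.
- by rewrite big_seq1 eqxx.
Qed.

(** Reduces identities between additive maps to homogeneous elements. The empty sum is covered
    because zero is homogeneous. *)
Lemma grading_ind (S : V -> Prop) :
  (forall x y, S x -> S y -> S (x + y)) -> (forall n x, x \in gr n -> S x) ->
  forall v, S v.
Proof.
move=> SD Sh v; have [s [c [ch ->]]] := grading_span grV v.
apply: (big_ind S); [exact: Sh (grading0 0)|exact: SD|move=> n _].
exact: Sh (ch n).
Qed.

Lemma decomposes_ex v : exists f s, decomposes v f s.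
Proof.
move: v; apply: grading_ind => [x y [f [s xf]] [g [s' yg]]|n x xn].
  have [t [xt yt]] := decomposes_common xf yg.
  by exists (fun n => 1 *: f n + g n), t; rewrite -[x]scale1r;
    exact: decomposesP.
by exists (fun m => if m == n then x else 0), [:: n]; exact: decomposes_hom.
Qed.

Lemma decomposes_unique v f g s s' :
  decomposes v f s -> decomposes v g s' -> f =1 g.
Proof.
move=> vf vg n; have [t [[fh ut f0 E] vgt]] := decomposes_common vf vg.
have [gh _ g0 E'] := vgt.
have [nt|/[dup] /f0-> /g0-> //] := boolP (n \in t).
apply/eqP; rewrite -subr_eq0; apply/eqP.
apply: (grading_free grV (s := t) (c := fun n => f n - g n)) => // [m|].
  exact: gradingB.
by rewrite sumrB -E -E' subrr.
Qed.

Definition component n v :=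
  xget 0 [set x | exists f s, decomposes v f s /\ x = f n].

Lemma componentE n v f s : decomposes v f s -> component n v = f n.
Proof.
move=> vf; apply: xget_unique; first by exists f, s.
by move=> _ [g [t [vg ->]]]; exact: (decomposes_unique vg vf).
Qed.

Lemma component_hom n v : component n v \in gr n.
Proof.
by have [f [s vf]] := decomposes_ex v; rewrite (componentE n vf); case: vf.
Qed.

Lemma component_id n x : x \in gr n -> component n x = x.
Proof. by move=> xn; rewrite (componentE n (decomposes_hom xn)) eqxx. Qed.

Lemma component_linear n : linear (component n).
Proof.
move=> c v w; have [f [s vf]] := decomposes_ex v.
have [g [s' wg]] := decomposes_ex w.
have [t [vt wt]] := decomposes_common vf wg.
by rewrite (componentE n (decomposesP c vt wt)) (componentE n vt)
  (componentE n wt).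
Qed.

Lemma componentD n : {morph component n : x y / x + y}.
Proof. by move=> x y; rewrite -{1}[x]scale1r component_linear scale1r. Qed.

Lemma component0 n : component n 0 = 0.
Proof. by rewrite component_id ?grading0. Qed.

Lemma component_sum v : exists s, v = \sum_(n <- s) component n v.
Proof.
have [f [s vf]] := decomposes_ex v; exists s.
by under eq_bigr do rewrite (componentE _ vf); case: vf.
Qed.

(** [T] carries a decomposition of [v] to one of [T v] with indices shifted by [j], and
    decompositions are unique. *)
Lemma component_homogeneous (T : {linear V -> V}) (j : int) :
  (forall n x, x \in gr n -> T x \in gr (n + j)) ->
  forall n v, T (component n v) = component (n + j) (T v).
Proof.
move=> Th n v; have [f [s vf]] := decomposes_ex v; rewrite (componentE n vf).
have Tf : decomposes (T v) (fun m => T (f (m - j))) [seq m + j | m <- s].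
  have [fh us f0 ->] := vf; split=> [m||m ms|].
  - by rewrite -{2}[m](subrK j) Th.
  - by rewrite map_inj_uniq //; exact: addIr.
  - rewrite f0 ?linear0 //; apply: contra ms => ms.
    by apply/mapP; exists (m - j); rewrite ?subrK.
  - by rewrite linear_sum big_map; apply: eq_bigr => m _; rewrite addrK.
by rewrite (componentE _ Tf) addrK.
Qed.

(** The sign of the degree as a global operator, defined on inhomogeneous vectors too. It supplies
    [eA] and [eB]. *)
Definition grading_sign v : V :=
  xget 0 [set x | exists f s,
    decomposes v f s /\ x = \sum_(n <- s) (-1) ^ n *: f n].

Lemma grading_signE v f s :
  decomposes v f s -> grading_sign v = \sum_(n <- s) (-1) ^ n *: f n.
Proof.
move=> vf; apply: xget_unique; first by exists f, s.
move=> _ [g [t [vg ->]]]; have [r [[_ ur _ _] _]] := decomposes_common vf vg.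
have E := decomposes_unique vg vf.
have [_ us f0 _] := vf; have [_ ut g0 _] := vg.
have sub (q q' : seq int) : {subset q <= undup (q ++ q')}.
  by move=> n nq; rewrite mem_undup mem_cat nq.
rewrite -(sum_support us (undup_uniq (s ++ t)) (@sub _ _)); last first.
  by move=> n /f0->; rewrite scaler0.
rewrite -(sum_support ut (undup_uniq (s ++ t))).
- by apply: eq_bigr => n _; rewrite E.
- by move=> n nt; rewrite mem_undup mem_cat nt orbT.
- by move=> n /g0->; rewrite scaler0.
Qed.

Lemma grading_sign_linear : linear grading_sign.
Proof.
move=> c v w; have [f [s vf]] := decomposes_ex v.
have [g [s' wg]] := decomposes_ex w.
have [t [vt wt]] := decomposes_common vf wg.
rewrite (grading_signE (decomposesP c vt wt)) (grading_signE vt)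
  (grading_signE wt).
rewrite scaler_sumr -big_split; apply: eq_bigr => n _ /=.
by rewrite scalerDr !scalerA mulrC.
Qed.

Lemma grading_sign_hom n x : x \in gr n -> grading_sign x = (-1) ^ n *: x.
Proof.
by move=> xn; rewrite (grading_signE (decomposes_hom xn)) big_seq1 eqxx.
Qed.

End Grading.

(** Bundles maps such as [green], whose linearity depends on hypotheses, so that the abstract
    transfer applies to them. *)
Lemma linear_pack (K : fieldType) (V W : lmodType K) (f : V -> W) :
  linear f -> exists h : {linear V -> W}, h =1 f.
Proof.
move=> fl; pose h : {linear V -> W} := HB.pack f
  (GRing.isLinear.Build _ _ _ _ f fl).
by exists h.
Qed.

(** * The Hodge homotopy *)

Section HodgeTheory.
Variables (K : fieldType) (A : dga K) (dstar : {linear A -> A}).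
Hypothesis hodge : hodge_decomposition dstar.
Local Notation H := (harmonic dstar).

Lemma hval_linear : linear (@hval _ _ dstar).
Proof. exact: (linearP (\val : {linear H -> A})). Qed.

(** The difference of two Hodge decompositions of [a] decomposes zero, so [hodge_free] applies. *)
Lemma harm_partE (a b c : A) (h : H) :
  a = hval h + diff b + dstar c -> harm_part dstar a = h.
Proof.
move=> E; apply: xget_unique; first by exists b, c.
move=> h' [b' [c' E']].
have /(hodge_free hodge)[/eqP + _ _] :
    hval (h' - h) + diff (b' - b) + dstar (c' - c) = 0.
  rewrite [h' - h]addrC -(scaleN1r h) hval_linear scaleN1r [- hval h + _]addrC
    !linearB /=.
  by rewrite [X in X + _]addrACA (addrACA (_ + _)) -!opprD -E' -E subrr.
by rewrite subr_eq0 => /eqP.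
Qed.

Lemma harm_partP (a : A) :
  exists b c, a = hval (harm_part dstar a) + diff b + dstar c.
Proof.
have [h [b [c E]]] := hodge_span hodge a.
by exists b, c; rewrite (harm_partE E).
Qed.

Lemma harm_part_linear : linear (harm_part dstar).
Proof.
move=> k x y; have [b [c E]] := harm_partP x; have [b' [c' E']] := harm_partP y.
apply: (@harm_partE _ (k *: b + b') (k *: c + c')).
rewrite {1}E {1}E' hval_linear !linearP /= !scalerDr.
by rewrite addrACA [X in X + _]addrACA.
Qed.

Lemma harm_part_diff b : harm_part dstar (diff b) = 0.
Proof. by apply: (@harm_partE _ b 0); rewrite linear0 addr0 add0r. Qed.

Lemma harm_part_dstar c : harm_part dstar (dstar c) = 0.
Proof. by apply: (@harm_partE _ 0 c); rewrite linear0 addr0 add0r. Qed.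

Lemma harm_part_id (h : H) : harm_part dstar (hval h) = h.
Proof. by apply: (@harm_partE _ 0 0); rewrite !linear0 !addr0. Qed.

Lemma harm_partD x y :
  harm_part dstar (x + y) = harm_part dstar x + harm_part dstar y.
Proof. by rewrite -{1}[x]scale1r harm_part_linear scale1r. Qed.

Hypothesis dstar_dstar : forall a, dstar (dstar a) = 0.
Hypothesis diff_harmonic : forall h : H, diff (hval h) = 0.
Hypothesis dstar_harmonic : forall h : H, dstar (hval h) = 0.

(** Decomposing [b], and then its coexact potential [c1], gives [diff b = diff (dstar (diff b3))],
    which is [box] of [diff b3]. Dually, [dstar c] is [box] of [dstar c4]. *)
Lemma green_ex (a : A) : exists g,
  box dstar g = a - hval (harm_part dstar a) /\ harm_part dstar g = 0.
Proof.
have [b [c E]] := harm_partP a.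
have [b1 [c1 E1]] := harm_partP b; have [b2 [c2 E2]] := harm_partP c.
have [b3 [c3 E3]] := harm_partP c1; have [b4 [c4 E4]] := harm_partP b2.
exists (diff b3 + dstar c4); split; last first.
  by rewrite harm_partD harm_part_diff harm_part_dstar addr0.
have -> : a - hval (harm_part dstar a) = diff b + dstar c.
  by apply: (canLR (addrK _)); rewrite {1}E [RHS]addrC addrA.
rewrite /box !linearD /= diff_diff dstar_dstar !linear0 addr0 add0r;
  congr (_ + _).
- rewrite E1 !linearD /= diff_harmonic diff_diff !add0r.
  by rewrite E3 !linearD /= dstar_harmonic dstar_dstar linear0 add0r !addr0.
- rewrite E2 !linearD /= dstar_harmonic dstar_dstar add0r addr0.
  by rewrite E4 !linearD /= diff_harmonic diff_diff linear0 !add0r.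
Qed.

(** Two candidates differ by a harmonic element with zero harmonic part, hence by zero. *)
Lemma greenE (a g : A) :
  box dstar g = a - hval (harm_part dstar a) -> harm_part dstar g = 0 ->
  green dstar a = g.
Proof.
move=> bg hg; apply: xget_unique => // g' [bg' hg'].
have bd : g' - g \in harmonic_pred dstar.
  rewrite inE addrC -scaleN1r box_is_linear bg bg' scaleN1r addNr //.
have hd : harm_part dstar (g' - g) = 0.
  by rewrite addrC -scaleN1r harm_part_linear hg hg' scaler0 addr0.
have := harm_part_id (Harmonic bd); rewrite /= hd.
move=> /(congr1 (@hval _ _ dstar)) /= /esym/eqP.
by rewrite subr_eq0 => /eqP.
Qed.

Lemma greenP (a : A) :
  box dstar (green dstar a) = a - hval (harm_part dstar a)
  /\ harm_part dstar (green dstar a) = 0.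
Proof. by have [g [bg hg]] := green_ex a; rewrite (greenE bg hg). Qed.

Lemma green_linear : linear (green dstar).
Proof.
move=> k x y; have [bx hx] := greenP x; have [by_ hy] := greenP y.
apply: greenE.
  rewrite box_is_linear bx by_ harm_part_linear.
  rewrite hval_linear /=.
  by rewrite scalerBr opprD addrACA.
by rewrite harm_part_linear hx hy scaler0 addr0.
Qed.

(** Since [box] commutes with [diff], the right side meets both conditions of [greenE]. *)
Lemma green_diff a : green dstar (diff a) = diff (green dstar a).
Proof.
have [ba ha] := greenP a; apply: greenE; last exact: harm_part_diff.
rewrite harm_part_diff subr0 -[in RHS](subrK (hval (harm_part dstar a)) a).
by rewrite -ba linearD /= diff_harmonic addr0 /box linearD /= !diff_diff
  linear0 addr0 add0r.
Qed.

Lemma hodge_homotopy_linear : linear (hodge_homotopy dstar).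
Proof. by move=> k x y; rewrite /hodge_homotopy green_linear linearP. Qed.

(** By [green_diff] the left side is [box] of [green dstar a]. *)
Lemma hodge_homotopyP a :
  diff (hodge_homotopy dstar a) + hodge_homotopy dstar (diff a)
  = a - hval (harm_part dstar a).
Proof. by rewrite /hodge_homotopy green_diff -(proj1 (greenP a)). Qed.

(** * Compatibility of the Hodge data with the grading *)

Hypothesis dstar_hom :
  forall n a, a \in dga_hom A n -> dstar a \in dga_hom A (n - 1).
Let grA := dga_hom_grading A.

Lemma box_hom n a : a \in dga_hom A n -> box dstar a \in dga_hom A n.
Proof.
move=> an; apply: (gradingD grA).
- by rewrite -[n](subrK 1) diff_hom ?dstar_hom.
- by rewrite -[n](addrK 1) dstar_hom ?diff_hom.
Qed.

Lemma box_component n a :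
  box dstar (component (dga_hom A) n a) = component (dga_hom A) n (box dstar a).
Proof.
have [b bE] := linear_pack (box_is_linear dstar); rewrite -!bE.
rewrite (component_homogeneous grA (j := 0)) ?addr0 // => m x xm.
by rewrite addr0 bE box_hom.
Qed.

Lemma component_harmonic n (h : H) :
  component (dga_hom A) n (hval h) \in harmonic_pred dstar.
Proof.
rewrite inE box_component; have : hval h \in harmonic_pred dstar by case: h.
by rewrite inE => /eqP->; rewrite component0.
Qed.

Lemma component_hodge n (h : H) b c :
  component (dga_hom A) n (hval h + diff b + dstar c) =
  hval (Harmonic (component_harmonic n h))
  + diff (component (dga_hom A) (n - 1) b)
  + dstar (component (dga_hom A) (n + 1) c).
Proof.
rewrite !componentD //=; congr (_ + _ + _).
- by rewrite (component_homogeneous grA (@diff_hom _ A)) subrK.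
- by rewrite (component_homogeneous grA (j := -1) dstar_hom) addrK.
Qed.

(** The degree [n] components of a Hodge decomposition of [a] again decompose [a], so uniqueness
    makes the harmonic part homogeneous. *)
Lemma harm_part_hom n a :
  a \in dga_hom A n -> harm_part dstar a \in @harmonic_hom _ _ dstar n.
Proof.
move=> an; have [b [c E]] := harm_partP a.
have := congr1 (component (dga_hom A) n) E.
rewrite component_hodge component_id // => /harm_partE->.
by rewrite inE /= component_hom.
Qed.

(** The degree [n] component of [green dstar a] satisfies the same characterization, so [greenE]
    identifies the two. *)
Lemma green_hom n a : a \in dga_hom A n -> green dstar a \in dga_hom A n.
Proof.
move=> an; have [ba ha] := greenP a.
suff -> : green dstar a = component (dga_hom A) n (green dstar a).
  exact: component_hom.
apply: greenE.
  rewrite box_component ba component_id //; apply: gradingB => //.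
  by have := harm_part_hom an; rewrite inE.
have [b [c E]] := harm_partP (green dstar a); rewrite ha in E.
rewrite E component_hodge harm_partD harm_part_dstar addr0 harm_partD.
rewrite harm_part_diff addr0 harm_part_id; apply/val_inj => /=.
by rewrite component0.
Qed.

Lemma hodge_homotopy_hom n a :
  a \in dga_hom A n -> hodge_homotopy dstar a \in dga_hom A (n - 1).
Proof. by move=> an; apply: dstar_hom; exact: green_hom. Qed.

Lemma harmonic_grading : is_grading (@harmonic_hom _ _ dstar).
Proof.
split=> [n|h|s c us ch E n ns].
- split; first by rewrite inE /=; exact: grading0.
  move=> k x y; rewrite !inE => xn yn.
  rewrite hval_linear.
  exact: gradingP.
- have [s E] := component_sum grA (hval h).
  exists s, (fun n => Harmonic (component_harmonic n h)); split=> [n|].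
    by rewrite inE /= component_hom.
  by apply: val_inj; rewrite raddf_sum /=.
- apply: val_inj; apply: (grading_free grA (s := s) (c := fun n => hval (c n)))
  => //.
  by have := congr1 (\val : {linear H -> A}) E; rewrite linear_sum linear0.
Qed.

End HodgeTheory.

(** The algebraic core: the transfer is applied to the harmonic projection, the inclusion and the
    Hodge homotopy. The vanishing hypotheses are what positivity of the metric yields. *)
Lemma hodge_Ainf (K : fieldType) (A : dga K) (dstar : {linear A -> A}) :
  hodge_decomposition dstar ->
  (forall a, dstar (dstar a) = 0) ->
  (forall h : harmonic dstar, diff (hval h) = 0) ->
  (forall h : harmonic dstar, dstar (hval h) = 0) ->
  (forall n a, a \in dga_hom A n -> dstar a \in dga_hom A (n - 1)) ->
  exists m : seq (harmonic dstar) -> harmonic dstar,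
    [/\ is_Ainf (@harmonic_hom _ _ dstar) m,
        forall a b, m [:: a; b] = circ a b
      & merkulov m].
Proof.
move=> hodge dstar2 d_harm dstar_harm dstar_hom.
have grA := dga_hom_grading A.
have grH := harmonic_grading dstar_hom.
have [eA eAE] := linear_pack (grading_sign_linear grA).
have [eB eBE] := linear_pack (grading_sign_linear grH).
have [P PE] := linear_pack (harm_part_linear hodge).
have [Q QE] := linear_pack (hodge_homotopy_linear hodge dstar2 d_harm
  dstar_harm).
pose i : {linear harmonic dstar -> A} := \val.
have eA_hom n x : x \in dga_hom A n -> eA x = (-1) ^ n *: x.
  by move=> xn; rewrite eAE (grading_sign_hom grA xn).
have eB_hom n x : x \in @harmonic_hom _ _ dstar n -> eB x = (-1) ^ n *: x.
  by move=> xn; rewrite eBE (grading_sign_hom grH xn).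
have i_hom n x : x \in @harmonic_hom _ _ dstar n -> i x \in dga_hom A n by [].
have P_hom n x : x \in dga_hom A n -> P x \in @harmonic_hom _ _ dstar n.
  by rewrite PE; exact: harm_part_hom.
have Q_hom n x : x \in dga_hom A n -> Q x \in dga_hom A (n - 1).
  by rewrite QE; exact: hodge_homotopy_hom.
(* This and the following sign identities are additive in each argument, so homogeneous elements
   suffice. *)
have eAK x : eA (eA x) = x.
  move: x; apply: (grading_ind grA) => [x y|n x xn];
    first by rewrite !linearD /= => -> ->.
  by rewrite (eA_hom _ _ xn) linearZ /= (eA_hom _ _ xn) scalerA expN1_sqr
    scale1r.
have eA_mu x y : eA (wedge x y) = wedge (eA x) (eA y).
  move: x; apply: (grading_ind grA) => [x x'|m x xm].
    by rewrite !(linearD, linearDl) /= => -> ->.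
  move: y; apply: (grading_ind grA) => [y y'|n y yn].
    by rewrite !(linearD, linearDr) /= => -> ->.
  rewrite (eA_hom _ _ xm) (eA_hom _ _ yn) (eA_hom _ _ (wedge_hom xm yn)).
  by rewrite linearZl_LR linearZr_LR /= scalerA expN1D.
have eA_d x : eA (diff x) = - diff (eA x).
  move: x; apply: (grading_ind grA) => [x y|n x xn].
    by rewrite !linearD /= => -> ->.
  rewrite (eA_hom _ _ xn) (eA_hom _ _ (diff_hom xn)) linearZ /=.
  by rewrite expN1D expr1z mulrN1 scaleNr.
have eA_Q x : eA (Q x) = - Q (eA x).
  move: x; apply: (grading_ind grA) => [x y|n x xn].
    by rewrite !linearD /= => -> ->.
  rewrite (eA_hom _ _ xn) (eA_hom _ _ (Q_hom _ _ xn)) linearZ /=.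
  by rewrite expN1D expN1N expr1z mulrN1 scaleNr.
have eA_i x : eA (i x) = i (eB x).
  move: x; apply: (grading_ind grH) => [x y|n x xn].
    by rewrite !linearD /= => -> ->.
  by rewrite (eB_hom _ _ xn) (eA_hom _ _ (i_hom _ _ xn)) linearZ.
have eB_P x : eB (P x) = P (eA x).
  move: x; apply: (grading_ind grA) => [x y|n x xn].
    by rewrite !linearD /= => -> ->.
  by rewrite (eA_hom _ _ xn) (eB_hom _ _ (P_hom _ _ xn)) linearZ.
have d_mu x y : diff (wedge x y) = wedge (diff x) y + wedge (eA x) (diff y).
  move: x; apply: (grading_ind grA) => [x x'|n x xn].
    by rewrite !(linearD, linearDl) /= => -> ->; rewrite addrACA.
  by rewrite (diff_wedge _ xn) (eA_hom _ _ xn) linearZl_LR.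
have d_i x : diff (i x) = 0 by exact: d_harm.
have P_d x : P (diff x) = 0 by rewrite PE harm_part_diff.
have homotopy x : diff (Q x) + Q (diff x) = x - i (P x).
  by rewrite !QE PE hodge_homotopyP.
have muA := @wedgeA _ A.
pose lambda a := transfer_mul wedge Q eA i (twist eB a).
exists (twisted wedge Q eA P i eB); split.
- split=> //.
  + exact: twisted_multilinear.
  + move=> p a _ pa; apply: (twisted_hom (grA := dga_hom A)) => //.
    * exact: grading_submod grA.
    * exact: grading_submod grH.
    * exact: wedge_hom.
  + move=> p a pa.
    exact: (twisted_stasheff eAK eA_mu eA_d eA_Q eA_i muA d_mu d_i P_d homotopy
      eB_P eB_hom (grading_submod grH) pa).
- move=> a b; rewrite /twisted /induced PE /circ; congr harm_part.
  rewrite /transfer_mul /= transfer_nil susp_mul0l susp_mul0r !addr0 add0r.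
  (* The [eB] that [twist] puts on the first entry cancels the [eA] inside [susp_mul]. *)
  by rewrite !transferE !transfer_mul1 linear0 !subr0 /= -[hval (eB a)]eA_i
    /susp_mul eAK.
- split; first by move=> x; rewrite /twisted /induced transfer_mul1 linear0.
  exists lambda => p a a1 pa; split; last by rewrite /twisted /induced PE.
  (* The convention that [Q lambda_1] is -1 makes this uniform in the length. The two minus signs
     cancel in each product. *)
  have QlambdaE b : Qlambda lambda b = - transfer wedge Q eA i (twist eB b).
    rewrite transferE opprB; case: b => [|x [|y b]] /=.
    + by rewrite /lambda /= transfer_mul_nil subr0 QE.
    + by rewrite transfer_mul1 linear0 sub0r.
    + by rewrite subr0 QE.
  rewrite /lambda (transfer_mul_twist eAK eA_mu eA_Q eA_i eB_hom
                    (grading_submod grH) a1 pa).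
  by apply: eq_bigr => k _; rewrite !QlambdaE linearNl linearNr opprK.
Qed.

(** * Consequences of positivity of the metric *)

Section Metric.
Variables (R : realType) (k : metric_kind) (A : dga (scalars R k)).
Variables (g : {dot A for @scalar_conj R k}) (dstar : {linear A -> A}).
Hypothesis dstar_adjoint : formal_adjoint dstar g.

Lemma dot_ge0 (a : A) : (0 <= g a a)%R.
Proof.
have [->|a0] := eqVneq a 0; first by rewrite raddf0.
by apply: Order.POrderTheory.ltW; exact: neq0_dnorm_gt0.
Qed.

Lemma dot_eq0 (a : A) : g a a = 0 -> a = 0.
Proof.
move=> ga; apply/eqP; apply: contraT => a0.
by have := neq0_dnorm_gt0 (s := g) a a0; rewrite ga Order.POrderTheory.ltxx.
Qed.

(** Moving both outer [dstar] across the metric in the squared norm produces [diff] twice. *)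
Lemma dstar_square (a : A) : dstar (dstar a) = 0.
Proof. by apply: dot_eq0; rewrite -!dstar_adjoint diff_diff linear0l. Qed.

(** Pairing [box h] with [h] gives the sum of the squared norms of [diff h] and [dstar h]. *)
Lemma harmonic_closed (h : harmonic dstar) :
  diff (hval h) = 0 /\ dstar (hval h) = 0.
Proof.
have : box dstar (hval h) = 0 by case: h => a /= /eqP.
move=> /(congr1 (g (hval h))); rewrite raddf0 /box raddfD /= -dstar_adjoint.
(* Adjointness concerns [diff] in the first slot, so Hermitian symmetry is used before and after. *)
have -> : g (hval h) (diff (dstar (hval h))) =
    g (dstar (hval h)) (dstar (hval h)).
  have gC x y : g x y = (-1) ^+ false * scalar_conj (g y x).
    exact: hermitian_subproof.
  by rewrite gC dstar_adjoint -gC.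
move=> /eqP; rewrite Num.Theory.paddr_eq0 ?dot_ge0 //.
by case/andP=> /eqP/dot_eq0-> /eqP/dot_eq0->.
Qed.

End Metric.

(** The third conjunct gives content to canonicity: by recursion on the length it fixes [m] on
    nonempty homogeneous lists, and multilinearity extends this to all nonempty lists. *)
Theorem theorem2p1 (R : realType) (k : metric_kind) (A : dga (scalars R k))
    (g : {dot A for @scalar_conj R k}) (dstar : {linear A -> A})
    (dstar_adjoint : formal_adjoint dstar g)
    (dstar_hom : forall n a, a \in dga_hom A n -> dstar a \in dga_hom A (n - 1))
    (hodge : hodge_decomposition dstar) :
  exists m : seq (harmonic dstar) -> harmonic dstar,
    [/\ is_Ainf (@harmonic_hom _ _ dstar) m,
        forall a b, m [:: a; b] = circ a b
      & merkulov m].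
Proof.
have closed := harmonic_closed dstar_adjoint.
apply: hodge_Ainf => //; first exact: dstar_square dstar_adjoint.
- by move=> h; case: (closed h).
- by move=> h; case: (closed h).
Qed.
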